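(* Let $\mathsf{P}\subset\mathrm{Top}$ be a full subcategory containing all compact Hausdorff spaces, and let $X$ be a completely regular Hausdorff topological space that admits a functorial $\mathsf{P}$-ification $i_X:X\to\nu_{\mathsf{P}}X$. Then $\nu_{\mathsf{P}}X=\tilde\nu_{\mathsf{P}}X$ as subspaces of $\beta X$.
   Context: $\mathrm{Top}$ denotes the category of completely regular Hausdorff topological spaces and continuous maps; all spaces are assumed to be such. A space $X$ admits a functorial $\mathsf{P}$-ification $i_X: X\to\nu_{\mathsf{P}}X$ if $\nu_{\mathsf{P}}X\in\mathsf{P}$, $i_X$ is continuous, and for every $Y\in\mathsf{P}$ and every continuous map $f:X\to Y$ there is a unique continuous map $\tilde f:\nu_{\mathsf{P}}X\to Y$ with $f=\tilde f\circ i_X$. $\beta X$ is the Stone–Čech compactification of $X$, and $\beta f:\beta X\to\beta Y$ is the map induced by a continuous map $f:X\to Y$. When $\mathsf{P}$ contains all compact Hausdorff spaces, the induced map $\beta i_X:\beta X\to\beta\nu_{\mathsf{P}}X$ is a homeomorphism, and $\nu_{\mathsf{P}}X$ is regarded as the subspace $(\beta i_X)^{-1}(\nu_{\mathsf{P}}X)$ of $\beta X$ (containing $X$). Define the subspace $$\tilde\nu_{\mathsf{P}}X=\bigcap\{(\beta f)^{-1}(Y)\mid f:X\to Y \text{ is a continuous map with } Y\in\mathsf{P}\}\subset\beta X,$$ where $Y$ is regarded as a subspace of $\beta Y$. *)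

(* Defs.v *)
From HB Require Import structures.
From mathcomp Require Import all_boot all_order all_algebra.
From mathcomp Require Import all_classical all_reals topology.
From mathcomp Require Import normedtype.

Set Implicit Arguments.
Unset Strict Implicit.
Unset Printing Implicit Defensive.

Import Order.TTheory GRing.Theory Num.Theory.
Import numFieldNormedType.Exports.

Local Open Scope classical_set_scope.
Local Open Scope ring_scope.

Definition tychonoff_space (T : topologicalType) : Prop :=
  completely_regular_space T /\ hausdorff_space T.

(* A full subcategory of the category of Tychonoff spaces is determined by its
   class of objects, which need not be closed under homeomorphism. *)
Definition full_subcategory (P : topologicalType -> Prop) : Prop :=
  forall Y : topologicalType, P Y -> tychonoff_space Y.

Definition contains_compact_hausdorff (P : topologicalType -> Prop) : Prop :=
  forall K : topologicalType,
    compact [set: K] -> hausdorff_space K -> P K.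

Record functorial_ification (P : topologicalType -> Prop)
    (X nuX : topologicalType) (i : continuousType X nuX) : Prop := {
  ification_obj : P nuX;
  ification_univ : forall (Y : topologicalType) (f : continuousType X Y),
    P Y -> exists! g : continuousType nuX Y, f = g \o i :> (X -> Y) }.

Section stone_cech.
Variable R : realType.

Definition unit_interval : topologicalType := set_type `[0%R : R, 1%R].

Definition cube (X : topologicalType) : topologicalType :=
  {ptws continuousType X unit_interval -> unit_interval}.

Definition cube_eval (X : topologicalType) (x : X) : cube X := fun g => g x.

(* The Stone-Cech compactification is the closure of the image of X in the cube
   indexed by all continuous maps from X to [0, 1]. *)
Definition beta (X : topologicalType) : topologicalType :=
  set_type (closure (range (@cube_eval X))).

Lemma beta_unit_subproof (X : topologicalType) (x : X) :
  cube_eval x \in closure (range (@cube_eval X)).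
Proof. by apply/mem_set; apply: subset_closure; exists x. Qed.

Definition beta_unit (X : topologicalType) (x : X) : beta X :=
  exist _ (cube_eval x) (beta_unit_subproof x).

Definition cube_map (X Y : topologicalType) (f : continuousType X Y)
  (p : cube X) : cube Y := fun g => p (g \o f).

Lemma cube_map_continuous (X Y : topologicalType) (f : continuousType X Y) :
  continuous (@cube_map X Y f).
Proof.
move=> p; apply/cvg_sup; first exact/fmap_filter/(nbhs_filter p).
move=> g A [_ /= [[V oV <-]]] /= Vpg /filterS.
apply; first exact/fmap_filter/(nbhs_filter p).
have /(_ V) := @proj_continuous (continuousType X unit_interval)
  (fun=> unit_interval) (g \o f) p; apply.
exact: open_nbhs_nbhs.
Qed.

Lemma cube_map_closure (X Y : topologicalType) (f : continuousType X Y)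
    (p : cube X) : closure (range (@cube_eval X)) p ->
  closure (range (@cube_eval Y)) (cube_map f p).
Proof.
move=> clp B /cube_map_continuous /clp [_ [[x _ <-] Bx]].
by exists (cube_eval (f x)); split; [exists (f x) | exact: Bx].
Qed.

Lemma beta_map_subproof (X Y : topologicalType) (f : continuousType X Y)
  (p : beta X) : cube_map f (val p) \in closure (range (@cube_eval Y)).
Proof. by apply/mem_set/cube_map_closure/set_mem; exact: valP. Qed.

Definition beta_map (X Y : topologicalType) (f : continuousType X Y)
  (p : beta X) : beta Y := exist _ (cube_map f (val p)) (beta_map_subproof f p).

(* beta_map f extends f and is continuous; as the image of X is dense in beta X
   and beta Y is Hausdorff, these two facts determine it. *)
Lemma beta_map_unit (X Y : topologicalType) (f : continuousType X Y) (x : X) :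
  beta_map f (beta_unit x) = beta_unit (f x).
Proof. exact: val_inj. Qed.

Lemma beta_map_continuous (X Y : topologicalType) (f : continuousType X Y) :
  continuous (@beta_map X Y f).
Proof.
apply/continuous_comp_initial => p.
apply: (@continuous_comp (beta X) (cube X) (cube Y) set_val).
  exact: initial_continuous.
exact: cube_map_continuous.
Qed.

(* nuX as a subspace of beta X: when P contains the compact Hausdorff spaces,
   beta_map i is a homeomorphism from beta X to beta nuX, which contains nuX
   through beta_unit. *)
Definition ification_in_beta (X nuX : topologicalType)
  (i : continuousType X nuX) : set (beta X) :=
  beta_map i @^-1` range (@beta_unit nuX).

Definition nu_tilde (P : topologicalType -> Prop) (X : topologicalType) :
  set (beta X) :=
  [set p | forall (Y : topologicalType) (f : continuousType X Y), P Y ->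
     (beta_map f @^-1` range (@beta_unit Y)) p].

End stone_cech.

(* Main.v *)
Require Import Defs.
From mathcomp Require Import all_boot all_order all_algebra.
From mathcomp Require Import all_classical all_reals topology normedtype.

(** Every map from [X] to an object of [P] factors through [i], so by
    functoriality of the Stone-Cech extension [beta_map f] is
    [beta_map g \o beta_map i] for the factor [g] ([beta_map_comp]). Since
    [beta_map g] carries the image of [nuX] into the image of [Y]
    ([beta_map_unit]), a point of [beta R X] that [beta_map i] sends into [nuX]
    is sent into [Y] by every such [f]. Conversely [i] is itself one of the maps
    over which the intersection defining [nu_tilde] is taken, because [nuX] is
    an object of [P]. *)

Set Implicit Arguments.
Unset Strict Implicit.
Unset Printing Implicit Defensive.

Local Open Scope classical_set_scope.

(** A point of [beta R X] is a function on the bundled continuous maps from [X]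
    to the unit interval, and [beta_map] reindexes it by precomposition. Hence
    functoriality is associativity of composition. The factorization is taken
    between underlying functions, which is how the universal property supplies
    it, and two bundled maps with the same underlying function are equal. *)
Lemma beta_map_comp (R : realType) (X Y Z : topologicalType)
    (f : continuousType X Y) (g : continuousType Y Z) (h : continuousType X Z) :
  h = g \o f :> (X -> Z) ->
  forall p : beta R X, beta_map h p = beta_map g (beta_map f p).
Proof.
move=> hgf p; apply: val_inj; apply/funext => k /=.
rewrite /cube_map; congr (val p _).
by apply/continuousEP => x /=; rewrite hgf.
Qed.

Theorem lemma1p8 (R : realType) (P : topologicalType -> Prop)
    (X nuX : topologicalType) (i : continuousType X nuX) :
  full_subcategory P ->
  contains_compact_hausdorff P ->
  tychonoff_space X ->
  functorial_ification P i ->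
  @ification_in_beta R X nuX i = @nu_tilde R P X.
Proof.
move=> _ _ _ [PnuX univ]; apply/seteqP; split=> p; last exact.
move=> [z _ zp] Y f PY.
have [g [fgi _]] := univ Y f PY.
by exists (g z) => //; rewrite (beta_map_comp fgi) -zp beta_map_unit.
Qed.
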